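(* Let $f:\mathbb{R}\to\mathbb{R}$ be twice differentiable with $f''(x)\ge 0$ for all $x\in\mathbb{R}$. Suppose that $\lim_{x\to-\infty} x f''(x)=A$ where $-\infty\le A<0$, and that $\lim_{x\to\infty} x f''(x)=B$ where $0<B\le\infty$. Then $I_f(P)=2$ for any point $P=(s,t)$ below the graph of $f$ (i.e. with $t<f(s)$).
   Context: The second derivative $f''$ is assumed to exist on all of $\mathbb{R}$ but is not assumed continuous. For a differentiable function $f$ on $\mathbb{R}$ and a point $P$ not on the graph of $f$, the illumination index $I_f(P)$ is the number of distinct lines that are tangent to the graph of $f$ (i.e. lines $y=f(c)+f'(c)(x-c)$ for some $c\in\mathbb{R}$) and pass through $P$; a line tangent at several points is counted once. The value $\infty$ is allowed in general. *)

(* Defs.v *)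
From HB Require Import structures.
From mathcomp Require Import all_boot all_order all_algebra.
From mathcomp Require Import all_classical all_reals all_analysis.

Set Implicit Arguments.
Unset Strict Implicit.
Unset Printing Implicit Defensive.

Import Order.TTheory GRing.Theory Num.Theory.
Import numFieldNormedType.Exports.

Local Open Scope ring_scope.
Local Open Scope classical_set_scope.

Definition tangent_line (R : realType) (f : R -> R) (c : R) : set (R * R) :=
  [set Q | Q.2 = f c + f^`()%classic c * (Q.1 - c)].

(* A line is a set of points of the plane, so a line tangent at several points
   is a single element of the set below. *)
Definition illuminating_lines (R : realType) (f : R -> R) (P : R * R) :
    set (set (R * R)) :=
  [set L | (exists c : R, L = tangent_line f c) /\ L P].

(* [counting] is the cardinality of a finite set and +oo on infinite sets. *)
Definition illumination_index (R : realType) (f : R -> R) (P : R * R) : \bar R :=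
  counting (illuminating_lines f P).

(* Main.v *)
Require Import Defs.
From HB Require Import structures.
From mathcomp Require Import all_boot all_order all_algebra.
From mathcomp Require Import finmap ring lra.
From mathcomp Require Import all_classical all_reals all_analysis.

Set Implicit Arguments.
Unset Strict Implicit.
Unset Printing Implicit Defensive.

Import Order.TTheory GRing.Theory Num.Theory.
Import numFieldNormedType.Exports.

Local Open Scope ring_scope.
Local Open Scope classical_set_scope.

(** Let [h c = f c + f' c * (s - c)] be the height at abscissa [s] of the tangent
line at [c]; that line passes through [(s, t)] exactly when [h c = t], and it is
then the line of slope [f' c] through [(s, t)].  Counting tangent lines through
the point thus means counting the slopes [f' c] at the solutions of [h c = t].

Existence: [h' c = f'' c * (s - c)].  For large positive [c] the product
[c * f'' c] stays above a positive constant and [s - c <= - c / 2], so [h'] is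
eventually below a negative constant and [h] tends to [-oo];
likewise at [-oo].  Since [h s = f s > t], the intermediate value theorem gives a
solution on each side of [s] ([tangent_through_left], [tangent_through_right]).

Counting: the graph lies above its tangents, and this inequality, used at [c] and
at [d], says that [h d - h c] lies between [(s - d) * (f' d - f' c)] and
[(s - c) * (f' d - f' c)] ([tangent_height_bounds]).  If [h c = h d = t] with [c]
and [d] on the same side of [s], both factors [s - c] and [s - d] have the same
sign, which forces [f' c = f' d]: each side contributes one line.  Solutions
[c < s < d] have [f' c < f' s < f' d], because [h s > t]: the two lines
differ. *)

Lemma mean_value (R : realType) (g : R -> R) (a b : R) :
  (forall x, derivable g x 1) -> a <= b ->
  exists2 c, a <= c <= b & g b - g a = g^`()%classic c * (b - a).
Proof.
move=> dg ab.
have dgE x : x \in `]a, b[%R -> is_derive x 1 g (g^`()%classic x).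
  by move=> _; rewrite derive1E; apply: derivableP.
have cg : {within `[a, b], continuous g}.
  by apply: derivable_within_continuous => x _.
by have [c] := MVT_segment ab dgE cg; rewrite in_itv/=; exists c.
Qed.

(** The mean value slope between [x] and [y] is a value of [f'] in between, and
[f'] is nondecreasing. *)
Lemma convex_above_tangent (R : realType) (f : R -> R) (x y : R) :
  (forall z, derivable f z 1) -> (forall z, derivable f^`()%classic z 1) ->
  (forall z, 0 <= f^`(2)%classic z) ->
  f x + f^`()%classic x * (y - x) <= f y.
Proof.
move=> df ddf f2_ge0.
have mono u v : u <= v -> f^`()%classic u <= f^`()%classic v.
  move=> uv; have [c _ fuv] := mean_value ddf uv.
  rewrite -subr_ge0 fuv mulr_ge0 ?subr_ge0//.
  by have := f2_ge0 c; rewrite derive1nS.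
have [xy|/ltW yx] := leP x y.
- have [c /andP[xc _] fxy] := mean_value df xy.
  have := mono _ _ xc; nra.
- have [c /andP[_ cx] fyx] := mean_value df yx.
  have := mono _ _ cx; nra.
Qed.

(** Height at abscissa [s] of the tangent line at [c], seen as a function of the
point of tangency. *)
Definition tangent_height (R : realType) (f : R -> R) (s c : R) : R :=
  f c + f^`()%classic c * (s - c).

Lemma tangent_height_id (R : realType) (f : R -> R) (s : R) :
  tangent_height f s s = f s.
Proof. by rewrite /tangent_height subrr mulr0 addr0. Qed.

(** Both inequalities are the tangent inequality, at [c] evaluated in [d] and at [d]
evaluated in [c].  Since they hold for every relative position of [c], [d] and [s],
the two sides of [s] can be treated together. *)
Lemma tangent_height_bounds (R : realType) (f : R -> R) (s c d : R) :
  (forall z, derivable f z 1) -> (forall z, derivable f^`()%classic z 1) ->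
  (forall z, 0 <= f^`(2)%classic z) ->
  (s - d) * (f^`()%classic d - f^`()%classic c) <= tangent_height f s d - tangent_height f s c
    <= (s - c) * (f^`()%classic d - f^`()%classic c).
Proof.
move=> df ddf f2_ge0; rewrite /tangent_height.
have := convex_above_tangent c d df ddf f2_ge0.
have := convex_above_tangent d c df ddf f2_ge0.
by move=> dc cd; apply/andP; split; lra.
Qed.

Lemma is_derive_tangent_height (R : realType) (f : R -> R) (s c : R) :
  (forall z, derivable f z 1) -> (forall z, derivable f^`()%classic z 1) ->
  is_derive c 1 (tangent_height f s) (f^`(2)%classic c * (s - c)).
Proof.
move=> df ddf.
have f1 : is_derive c 1 f (f^`()%classic c) by rewrite derive1E; apply: derivableP.
have f2 : is_derive c 1 f^`()%classic (f^`(2)%classic c).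
  by rewrite derive1nS derive1E; apply: derivableP.
rewrite /tangent_height; apply: is_derive_eq.
rewrite /GRing.scale/=; lra.
Qed.

(** A slope at most [- k] on a half-line makes [g] tend to [-oo], so the
intermediate value theorem applies from [s] on. *)
Lemma attains_below_of_derive_le (R : realType) (g dg : R -> R) (k M s t : R) :
  (forall x : R, is_derive x 1 g (dg x)) -> 0 < k ->
  (forall x, M <= x -> dg x <= - k) -> t < g s ->
  exists2 c, s < c & g c = t.
Proof.
move=> gE k0 slope tgs.
have dgx x : derivable g x 1 by have [] := gE x.
pose N := Num.max M s.
have MN : M <= N by rewrite /N le_max lexx.
have sN : s <= N by rewrite /N le_max lexx orbT.
(* Descending from [g N] at rate [k] over this length ends at or below [t]. *)
pose X := N + `|g N - t| / k.
have NX : N <= X by rewrite lerDl divr_ge0// ltW.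
have sX := le_trans sN NX.
have gX : g X <= t.
  have [c /andP[Nc _]] := mean_value dgx NX.
  have XN : k * (X - N) = `|g N - t| by rewrite /X; field; rewrite gt_eqF.
  rewrite derive1E derive_val.
  by have := slope _ (le_trans MN Nc); have := ler_norm (g N - t); nra.
have [c] : exists2 c, c \in `[s, X]%R & g c = t.
  apply: IVT => //; first by apply: derivable_within_continuous => x _.
  by rewrite ge_min le_max gX (ltW tgs) orbT.
rewrite in_itv/= => /andP[sc _] gc; exists c => //.
by rewrite lt_neqAle sc andbT; apply: contraTneq tgs => ->; rewrite gc ltxx.
Qed.

(** Beyond [max 0 (2 * s)] one has [x - s >= x / 2], so that the bound
[b < x * f'' x] makes the derivative [f'' x * (s - x)] at most [- b / 2]. *)
Lemma tangent_through_right (R : realType) (f : R -> R) (b s t : R) :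
  (forall z, derivable f z 1) -> (forall z, derivable f^`()%classic z 1) ->
  (forall z, 0 <= f^`(2)%classic z) ->
  0 < b -> (\forall x \near +oo, b < x * f^`(2)%classic x) -> t < f s ->
  exists2 c, s < c & tangent_height f s c = t.
Proof.
move=> df ddf f2_ge0 b0 [N [_ bN]] tfs.
apply: (@attains_below_of_derive_le _ _ (fun x => f^`(2)%classic x * (s - x)) (b / 2)
  (1 + `|N| + 2 * `|s|)).
- by move=> x; exact: is_derive_tangent_height.
- by rewrite divr_gt0.
- move=> x Mx; have Nx : N < x by have := ler_norm N; have := normr_ge0 s; lra.
  have sx : 2 * s <= x by have := ler_norm s; have := normr_ge0 N; lra.
  by have := bN _ Nx; have := f2_ge0 x; rewrite /=; nra.
- by rewrite tangent_height_id.
Qed.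

(** Mirror image of the previous lemma, through the substitution [x |-> - x] in the
tangent height. *)
Lemma tangent_through_left (R : realType) (f : R -> R) (a s t : R) :
  (forall z, derivable f z 1) -> (forall z, derivable f^`()%classic z 1) ->
  (forall z, 0 <= f^`(2)%classic z) ->
  a < 0 -> (\forall x \near -oo, x * f^`(2)%classic x < a) -> t < f s ->
  exists2 c, c < s & tangent_height f s c = t.
Proof.
move=> df ddf f2_ge0 a0 [N [_ aN]] tfs.
have [||||c sc hc] := @attains_below_of_derive_le _ (tangent_height f s \o -%R)
    (fun x => f^`(2)%classic (- x) * (s + x) * -1) (- a / 2) (1 + `|N| + 2 * `|s|)
    (- s) t.
- move=> x; have h1 := is_derive_tangent_height s (- x) df ddf.
  by apply: is_derive1_comp; rewrite opprK in h1.
- by rewrite divr_gt0 ?oppr_gt0.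
- move=> x Mx; have Nx : - x < N.
    by have := ler_norm (- N); rewrite normrN; have := normr_ge0 s; lra.
  have sx : - 2 * s <= x.
    by have := ler_norm (- s); rewrite normrN; have := normr_ge0 N; lra.
  by have := aN _ Nx; have := f2_ge0 (- x); rewrite /=; nra.
- by rewrite /= opprK tangent_height_id.
- by exists (- c) => //; rewrite ltrNl.
Qed.

Lemma counting_set2 (R : realType) (T : choiceType) (x y : T) :
  x != y -> counting [set x; y] = 2%:E :> \bar R.
Proof.
move=> xy; rewrite /counting asboolT; last exact: finite_set2.
by rewrite fset_setU1// fset_set1 cardfs2 xy.
Qed.

Theorem theorem2p3 (R : realType) (f : R -> R) (A B : \bar R)
  (f_derivable : forall x : R, derivable f x 1)
  (df_derivable : forall x : R, derivable f^`() x 1)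
  (ddf_ge0 : forall x : R, 0 <= f^`(2)%classic x)
  (A_lt0 : (A < 0)%E)
  (limA : (x * f^`(2)%classic x)%:E @[x --> -oo] --> A)
  (B_gt0 : (0 < B)%E)
  (limB : (x * f^`(2)%classic x)%:E @[x --> +oo] --> B)
  (s t : R) (P_below : t < f s) :
  illumination_index f (s, t) = 2%:E.
Proof.
pose h := tangent_height f s.
have bounds c d := tangent_height_bounds s c d f_derivable df_derivable ddf_ge0.
have lineE c : h c = t ->
    tangent_line f c = [set Q | Q.2 = t + f^`()%classic c * (Q.1 - s)].
  move=> <-; rewrite /tangent_line; apply/seteqP.
  by split=> -[x y] /= ->; rewrite /h /tangent_height; lra.
have lineP c : tangent_line f c (s, t) <-> h c = t.
  by rewrite /tangent_line /h /tangent_height /=; split=> ->.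
have same_side c d : 0 < (s - c) * (s - d) -> h c = t -> h d = t ->
    tangent_line f c = tangent_line f d.
  move=> cd hc hd; rewrite !lineE//.
  suff -> : f^`()%classic c = f^`()%classic d by [].
  have := bounds c d; rewrite -/h hc hd subrr => /andP[ub lb].
  (* The two bounds of opposite signs multiply to
     [(s - d) * (s - c) * (f' d - f' c) ^ 2 <= 0]. *)
  apply/eqP; rewrite eq_sym -subr_eq0 -sqrf_eq0 eq_le sqr_ge0 andbT.
  rewrite -(pmulr_rle0 _ cd); apply: le_trans (mulr_le0_ge0 ub lb).
  by rewrite le_eqVlt; apply/orP; left; apply/eqP; ring.
have [a a0 Aa] : exists2 a : R, a < 0 & (A < a%:E)%E.
  case: A A_lt0 {limA} => [r|//|_]; last by exists (-1) => //; rewrite ltNyr.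
  by rewrite lte_fin => r0; exists (r / 2); rewrite ?lte_fin; lra.
have [b b0 bB] : exists2 b : R, 0 < b & (b%:E < B)%E.
  case: B B_gt0 {limB} => [r|_|//]; last by exists 1 => //; rewrite ltry.
  by rewrite lte_fin => r0; exists (r / 2); rewrite ?lte_fin; lra.
have nearA : \forall x \near -oo, x * f^`(2)%classic x < a.
  exact: limA (open_ereal_lt' Aa).
have nearB : \forall x \near +oo, b < x * f^`(2)%classic x.
  exact: limB (open_ereal_gt' bB).
have [c cs hc] :=
  tangent_through_left f_derivable df_derivable ddf_ge0 a0 nearA P_below.
have [d sd hd] :=
  tangent_through_right f_derivable df_derivable ddf_ge0 b0 nearB P_below.
have cd : tangent_line f c != tangent_line f d.
  apply/eqP; rewrite !lineE// => /seteqP[sub_cd _].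
  (* One unit to the right of [s], the heights of the lines compare the slopes. *)
  have /addrI : t + f^`()%classic c = t + f^`()%classic d * (s + 1 - s).
    by apply: (sub_cd (s + 1, t + f^`()%classic c)) => /=; ring.
  rewrite addrAC subrr add0r mulr1 => fcd.
  have := bounds c s; have := bounds d s.
  rewrite hc hd tangent_height_id fcd => /andP[_ ubd] /andP[_ ubc].
  (* A common slope would be both below and above [f' s]. *)
  have gap : 0 < f s - t by rewrite subr_gt0.
  have := lt_le_trans gap ubc; rewrite pmulr_rgt0 ?subr_gt0// => lt_ds.
  have := lt_le_trans gap ubd; rewrite nmulr_rgt0 ?subr_lt0//.
  by move/(lt_trans lt_ds); rewrite ltxx.
rewrite /illumination_index -(counting_set2 R cd); congr counting.
apply/seteqP; split=> [L [[e ->]] /lineP he|L [|] ->]; last 2 first.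
- by split; [exists c|exact/lineP].
- by split; [exists d|exact/lineP].
have [es|se|es] := ltgtP e s.
- by left; apply: same_side; rewrite // mulr_gt0 ?subr_gt0.
- by right; apply: same_side; rewrite // nmulr_rgt0 subr_lt0.
- by move: P_below; rewrite -he es /h tangent_height_id ltxx.
Qed.
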